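(* Let $D=\operatorname{diag}(1,1/2)$, $Y^*=\operatorname{diag}(1,0)$, $Q(Y)=\frac12\|D(Y-Y^* )\|^2$ for $Y\in\mathbb{R}^{2\times 2}$, and define the polynomial $f\colon\mathbb{R}^{3\times 3}\to\mathbb{R}$ by $$f(X)=Q(X_{1:2,1:2})-\frac{(X_{3,3}+1)^2}{2}+\frac{X_{3,3}^4}{4},$$ where $X_{1:2,1:2}$ is the upper-left $2\times2$ block of $X$. Let $\mathcal{X}=\mathbb{R}^{3\times 3}_{\leq 2}$ be the set of $3\times 3$ matrices of rank at most $2$, let $X_0=\operatorname{diag}(2,1,0)$ and $\alpha=8/5$. Then $f$ is bounded below, and the iteration $$X_{k+1}=\operatorname{Proj}_{\mathcal{X}}\bigl(X_k+\alpha\operatorname{Proj}_{\mathrm{T}_{X_k}\mathcal{X}}(-\nabla f(X_k))\bigr),\qquad k\geq 0,$$ generates a sequence such that: (1) $\operatorname{rank}(X_k)=2$ for all $k$; (2) $(X_k)$ converges to $\bar X=\operatorname{diag}(1,0,0)$, which has rank $1$; (3) $\|\operatorname{Proj}_{\mathrm{T}_{X_k}\mathcal{X}}(-\nabla f(X_k))\|=\frac{\sqrt{17}}{4}(3/5)^k\to 0$; (4) $\operatorname{Proj}_{\mathrm{T}_{\bar X}\mathcal{X}}(-\nabla f(\bar X))=-\nabla f(\bar X)\neq 0$, so that $\bar X$ is not stationary for $f$ on $\mathcal{X}$; (5) for all $k$ the sufficient decrease condition $f(X_k)-f(X_{k+1})\geq\tau\alpha\|\operatorname{Proj}_{\mathrm{T}_{X_k}\mathcal{X}}(-\nabla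 f(X_k))\|^2$ holds with $\tau=1/5$.
   Context: Norms are Frobenius norms, and $\nabla f$ is the gradient with respect to $\langle A,B\rangle=\operatorname{Tr}(A^\top B)$. The tangent cone to $\mathcal{X}$ at $X$ is $\mathrm{T}_X\mathcal{X}=\{v=\lim_{k\to\infty}(Z_k-X)/\tau_k : Z_k\in\mathcal{X},\ \tau_k>0,\ \tau_k\to 0,\text{ the limit exists}\}$. $\operatorname{Proj}_S(z)$ denotes a closest point of the closed set $S$ to $z$. A point $X\in\mathcal{X}$ is stationary if $\mathrm{D}f(X)[v]\geq0$ for all $v\in\mathrm{T}_X\mathcal{X}$ (equivalently, $\|\operatorname{Proj}_{\mathrm{T}_X\mathcal{X}}(-\nabla f(X))\|=0$). *)

(* Defs.v *)
From HB Require Import structures.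
From mathcomp Require Import all_boot all_order all_algebra.
From mathcomp Require Import all_classical all_reals all_analysis.

Set Implicit Arguments.
Unset Strict Implicit.
Unset Printing Implicit Defensive.

Import Order.TTheory GRing.Theory Num.Theory.
Import numFieldNormedType.Exports.

Local Open Scope classical_set_scope.
Local Open Scope ring_scope.

Section frobenius.
Context {R : realType} {m n : nat}.
Implicit Types (A B X z v : 'M[R]_(m, n)) (S : set 'M[R]_(m, n)).

Definition frob_inner A B : R := \tr (A^T *m B).

(* The library norm `|A| on matrices is the max norm, so the Frobenius norm
   needs its own name; both induce the same topology, hence limits of matrices
   are taken in the library topology. *)
Definition frob A : R := Num.sqrt (frob_inner A A).

(* All closest points of S to z: the metric projection onto a nonconvex set
   need not be single-valued. *)
Definition Proj S z : set 'M[R]_(m, n) :=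
  [set p | S p /\ forall q, S q -> frob (z - p) <= frob (z - q)].

Definition tangent_cone S X : set 'M[R]_(m, n) :=
  [set v | exists (Z : nat -> 'M[R]_(m, n)) (tau : nat -> R),
    [/\ forall k, S (Z k),
        forall k, 0 < tau k,
        tau k @[k --> \oo] --> (0 : R) &
        (tau k)^-1 *: (Z k - X) @[k --> \oo] --> v]].

(* The Riesz representative of the differential for the Frobenius inner
   product; the differential is always linear, so it exists and is unique. *)
Definition grad (f : 'M[R]_(m, n) -> R) X : 'M[R]_(m, n) :=
  xget 0 [set G | forall v, 'd f X v = frob_inner G v].

(* Meant for X in S. *)
Definition stationary (f : 'M[R]_(m, n) -> R) S X : Prop :=
  forall v, tangent_cone S X v -> 0 <= 'd f X v.

(* X is a sequence of iterates of projected-projected gradient descent, and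
   V k is the closest point of the tangent cone at X k to - grad f (X k) that is
   selected at step k. *)
Definition pgd (f : 'M[R]_(m, n) -> R) S (alpha : R) (X0 : 'M[R]_(m, n))
    (X V : nat -> 'M[R]_(m, n)) : Prop :=
  X 0%N = X0 /\
  forall k, Proj (tangent_cone S (X k)) (- grad f (X k)) (V k) /\
            Proj S (X k + alpha *: V k) (X k.+1).

End frobenius.

Definition bounded_rank (R : realType) (m n r : nat) : set 'M[R]_(m, n) :=
  [set X | (\rank X <= r)%N].

Definition diag (R : realType) (n : nat) (s : seq R) : 'M[R]_n :=
  diag_mx (\row_(i < n) s`_i).

Definition Q (R : realType) (Y : 'M[R]_2) : R :=
  2^-1 * frob (diag 2 [:: 1; 2^-1] *m (Y - diag 2 [:: 1; 0])) ^+ 2.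

Definition f_ex (R : realType) (X : 'M[R]_3) : R :=
  let x33 := X ord_max ord_max in
  Q (ulsubmx (X : 'M[R]_(2 + 1, 2 + 1))) - (x33 + 1) ^+ 2 / 2 + x33 ^+ 4 / 4.

(* Main.v *)
(** At diag(a, b, 0) with a, b nonzero every tangent direction has zero (3,3)
entry, so the projected antigradient misses the component of - grad f along
E_33. Started from diag(2, 1, 0), the iteration therefore stays among the
matrices diag(a, b, 0), on which f is quadratic and a step maps (a - 1, b) to
(- 3/5 (a - 1), 3/5 b). Hence X_k = diag(1 + (-3/5)^k, (3/5)^k, 0), with no
choice in either projection. The limit diag(1, 0, 0) has rank 1, where E_33 is
tangent again and is exactly the antigradient. *)

Require Import Defs.
From HB Require Import structures.
From mathcomp Require Import all_boot all_order all_algebra.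
From mathcomp Require Import all_classical all_reals all_analysis.
From mathcomp Require Import ring lra.

Set Implicit Arguments.
Unset Strict Implicit.
Unset Printing Implicit Defensive.

Import Order.TTheory GRing.Theory Num.Theory.
Import numFieldNormedType.Exports.

Local Open Scope classical_set_scope.
Local Open Scope ring_scope.

(** * Frobenius inner product, projections and gradients *)

Section FrobeniusTheory.
Context {R : realType} {m n : nat}.
Implicit Types (A B C z p q : 'M[R]_(m, n)) (S : set 'M[R]_(m, n)).

Lemma frob_innerE A B : frob_inner A B = \sum_i \sum_j A i j * B i j.
Proof.
rewrite /frob_inner /mxtrace exchange_big /=; apply: eq_bigr => j _.
by rewrite !mxE; apply: eq_bigr => i _; rewrite mxE.
Qed.

Lemma frob_innerC A B : frob_inner A B = frob_inner B A.
Proof.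
by rewrite !frob_innerE; do 2!apply: eq_bigr => ? _; rewrite mulrC.
Qed.

Lemma frob_innerDl A B C :
  frob_inner (A + B) C = frob_inner A C + frob_inner B C.
Proof. by rewrite /frob_inner linearD mulmxDl linearD. Qed.

Lemma frob_innerNl A B : frob_inner (- A) B = - frob_inner A B.
Proof. by rewrite /frob_inner linearN mulNmx linearN. Qed.

Lemma frob_inner_ge0 A : 0 <= frob_inner A A.
Proof.
by rewrite frob_innerE; do 2!apply: sumr_ge0 => ? _; rewrite -expr2 sqr_ge0.
Qed.

Lemma frob_inner_eq0 A : (frob_inner A A == 0) = (A == 0).
Proof.
apply/eqP/eqP => [A0|->]; last by rewrite /frob_inner mulmx0 mxtrace0.
have sq_ge0 i j : 0 <= A i j * A i j by rewrite -expr2 sqr_ge0.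
apply/matrixP => i j; rewrite mxE; apply/eqP.
move: A0; rewrite frob_innerE => /psumr_eq0P row0.
have /psumr_eq0P ent0 : \sum_j A i j * A i j = 0.
  by apply: row0 => // k _; apply: sumr_ge0.
by rewrite -sqrf_eq0 expr2 ent0.
Qed.

Lemma frob_inner_inj A B :
  (forall v, frob_inner A v = frob_inner B v) -> A = B.
Proof.
move=> AB; apply/eqP; rewrite -subr_eq0 -frob_inner_eq0.
by rewrite frob_innerDl frob_innerNl AB subrr.
Qed.

Lemma sqr_frob A : frob A ^+ 2 = frob_inner A A.
Proof. by rewrite sqr_sqrtr ?frob_inner_ge0. Qed.

Lemma frob_ge0 A : 0 <= frob A.
Proof. exact: sqrtr_ge0. Qed.

Lemma ler_frob A B : (frob A <= frob B) = (frob_inner A A <= frob_inner B B).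
Proof. by rewrite -!sqr_frob ler_sqr ?nnegrE ?frob_ge0. Qed.

Lemma frob_inner_sqrB A B : frob_inner (A - B) (A - B) =
  frob_inner A A - 2 * frob_inner A B + frob_inner B B.
Proof.
rewrite !frob_innerDl !frob_innerNl !(frob_innerC _ (A - B)) !frob_innerDl.
by rewrite !frob_innerNl (frob_innerC B A); ring.
Qed.

(** By Pythagoras, the squared distance from [z] to [q] exceeds that to [p] by exactly the squared
    norm of [q - p]. This gives minimality and uniqueness together, also for nonconvex [S]. *)
Lemma Proj_orthogonal S z p :
  S p -> (forall q, S q -> frob_inner (z - p) (q - p) = 0) -> Proj S z = [set p].
Proof.
move=> Sp zp_orth.
have pythagoras q : S q -> frob_inner (z - q) (z - q) =
    frob_inner (z - p) (z - p) + frob_inner (q - p) (q - p).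
  move=> Sq; have -> : z - q = (z - p) - (q - p) by rewrite opprB addrA subrK.
  by rewrite frob_inner_sqrB (zp_orth q)// mulr0 subr0.
apply/seteqP; split => [q [Sq /(_ p Sp)]|_ ->].
  rewrite ler_frob pythagoras// gerDl => qp_le0.
  apply/eqP; rewrite -subr_eq0 -frob_inner_eq0.
  by rewrite eq_le qp_le0 frob_inner_ge0.
by split=> // q Sq; rewrite ler_frob (pythagoras q)// lerDl frob_inner_ge0.
Qed.

Lemma Proj_id S z : S z -> Proj S z = [set z].
Proof.
move=> Sz; apply: Proj_orthogonal => // q _.
by rewrite subrr /frob_inner trmx0 mul0mx mxtrace0.
Qed.

Lemma grad_eq (f : 'M[R]_(m, n) -> R) X G :
  (forall v, 'd f X v = frob_inner G v) -> grad f X = G.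
Proof.
move=> fG; apply: frob_inner_inj => v; rewrite -fG /grad.
(* The default value of [xget] is ruled out because [G] is itself a representative. *)
by case: xgetP => [_ -> /(_ v) //|/(_ G)]; rewrite /= fG.
Qed.

End FrobeniusTheory.

(** * The rank constraint as a determinant equation *)

Lemma bounded_rankE (R : realType) (n : nat) (A : 'M[R]_n.+1) :
  bounded_rank n A <-> \det A = 0.
Proof.
rewrite /bounded_rank /= -ltnS ltn_neqAle rank_leq_row andbT.
rewrite -[\rank A == _]/(row_free A) row_free_unit unitmxE unitfE negbK.
by split => /eqP.
Qed.

Lemma big_ord3 (V : nmodType) (F : 'I_3 -> V) :
  \sum_i F i = F 0 + F 1 + F ord_max.
Proof.
rewrite !big_ord_recr big_ord0 /= add0r.
by congr (F _ + F _ + F _); apply: val_inj.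
Qed.

Lemma det_mx3 (R : comNzRingType) (A : 'M[R]_3) : \det A =
  A 0 0 * (A 1 1 * A ord_max ord_max - A 1 ord_max * A ord_max 1)
  - A 0 1 * (A 1 0 * A ord_max ord_max - A 1 ord_max * A ord_max 0)
  + A 0 ord_max * (A 1 0 * A ord_max 1 - A 1 1 * A ord_max 0).
Proof.
(* Indexing by natural numbers lets the ordinals produced by the cofactor expansion compute, so that
   [ring] identifies equal entries. *)
pose a i j := A (inord i) (inord j).
have aE i j : A i j = a i j by rewrite /a !inord_val.
rewrite (expand_det_row _ 0) big_ord3 /cofactor.
rewrite !(expand_det_row _ ord0) !big_ord_recr !big_ord0 /cofactor !det_mx11.
rewrite !mxE !aE /= /bump /=.
by ring.
Qed.

(** * Diagonal 3 x 3 matrices *)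

Section Diagonal.
Context {R : realType}.
Implicit Types a b c : R.

Lemma diag3E a b c (i j : 'I_3) :
  diag 3 [:: a; b; c] i j = [:: a; b; c]`_j *+ (i == j).
Proof. by rewrite !mxE; case: eqP => [->|]. Qed.

Lemma frob_inner_diag3 a b c (A : 'M[R]_3) :
  frob_inner (diag 3 [:: a; b; c]) A =
  a * A 0 0 + b * A 1 1 + c * A ord_max ord_max.
Proof.
by rewrite frob_innerE !big_ord3 !diag3E /=; ring.
Qed.

Lemma add_diag3 a b c a' b' c' :
  diag 3 [:: a; b; c] + diag 3 [:: a'; b'; c'] =
  diag 3 [:: a + a'; b + b'; c + c'].
Proof.
apply/matrixP => i j; rewrite mxE !diag3E -mulrnDl.
by case: j => -[|[|[]]].
Qed.

Lemma scale_diag3 k a b c :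
  k *: diag 3 [:: a; b; c] = diag 3 [:: k * a; k * b; k * c].
Proof.
apply/matrixP => i j; rewrite mxE !diag3E mulrnAr.
by case: j => -[|[|[]]].
Qed.

Lemma opp_diag3 a b c :
  - diag 3 [:: a; b; c] = diag 3 [:: - a; - b; - c].
Proof. by rewrite -scaleN1r scale_diag3 !mulN1r. Qed.

Lemma det_diag3 a b c : \det (diag 3 [:: a; b; c]) = a * b * c.
Proof. by rewrite det_mx3 !diag3E /=; ring. Qed.

Lemma bounded_rank_diag3 a b : bounded_rank 2 (diag 3 [:: a; b; 0]).
Proof. by apply/bounded_rankE; rewrite det_diag3 mulr0. Qed.

(** An invertible factor preserves rank. A diagonal matrix with trailing zeros has this form:
    [pid_mx r] creates the zeros, and the entries it erases may be taken to be 1. *)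
Lemma rank_diag3_mulmx_pid a b c r :
  a * b * c != 0 -> (r <= 3)%N ->
  \rank (diag 3 [:: a; b; c] *m (pid_mx r : 'M[R]_3)) = r.
Proof.
move=> abc r3; rewrite (eqmxMfull (pid_mx r)) ?rank_pid_mx//.
by rewrite row_full_unit unitmxE det_diag3 unitfE.
Qed.

Lemma rank_diag3_2 a b : a != 0 -> b != 0 -> \rank (diag 3 [:: a; b; 0]) = 2%N.
Proof.
move=> a0 b0; rewrite -[RHS](@rank_diag3_mulmx_pid a b 1)// ?mulr1 ?mulf_neq0//.
congr mxrank; apply/matrixP => i j; rewrite !mxE big_ord3 !diag3E !mxE.
by case: i => -[|[|[]]]//; case: j => -[|[|[]]]//= *; ring.
Qed.

Lemma rank_diag3_1 a : a != 0 -> \rank (diag 3 [:: a; 0; 0]) = 1%N.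
Proof.
move=> a0; rewrite -[RHS](@rank_diag3_mulmx_pid a 1 1)// ?mulr1//.
congr mxrank; apply/matrixP => i j; rewrite !mxE big_ord3 !diag3E !mxE.
by case: i => -[|[|[]]]//; case: j => -[|[|[]]]//= *; ring.
Qed.

Lemma sqr_frob_diag3 a b c :
  frob (diag 3 [:: a; b; c]) ^+ 2 = a ^+ 2 + b ^+ 2 + c ^+ 2.
Proof. by rewrite sqr_frob frob_inner_diag3 !diag3E /=; ring. Qed.

Lemma cvg_diag3 (T : Type) (F : set_system T) (FF : Filter F) (a b c : T -> R)
    (a' b' c' : R) :
  a x @[x --> F] --> a' -> b x @[x --> F] --> b' -> c x @[x --> F] --> c' ->
  diag 3 [:: a x; b x; c x] @[x --> F] --> diag 3 [:: a'; b'; c'].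
Proof.
have diagE u v w : diag 3 [:: u; v; w] = u *: diag 3 [:: 1; 0; 0] +
    v *: diag 3 [:: 0; 1; 0] + w *: diag 3 [:: 0; 0; 1] :> 'M[R]_3.
  by rewrite !scale_diag3 !add_diag3 !(mulr0, mulr1, addr0, add0r).
move=> aa bb cc; rewrite diagE; under eq_fun do rewrite diagE.
by apply: cvgD; [apply: cvgD|]; apply: cvgZ => //; exact: cvg_cst.
Qed.

End Diagonal.

(** * Tangent directions to the bounded-rank set *)

Section TangentCone.
Context {R : realType}.
Implicit Types a b c : R.

(* At X = diag(a, b, 0), det (X + t w) = t a b w_33 + O(t^2), and it vanishes
   along the sequences defining the cone. *)
Lemma tangent_cone_rank2 a b (v : 'M[R]_3) : a != 0 -> b != 0 ->
  tangent_cone (@bounded_rank R 3 3 2) (diag 3 [:: a; b; 0]) v ->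
  v ord_max ord_max = 0.
Proof.
move=> a0 b0 [Z [tau [Zrank tau_gt0 tau0]]].
set X := diag _ _; set w := fun k => (tau k)^-1 *: (Z k - X) => wv.
have ZE k : Z k = X + tau k *: w k.
  by rewrite /w scalerA mulfV ?gt_eqF// scale1r addrC subrK.
have wcvg i j : w k i j @[k --> \oo] --> v i j.
  exact: (cvg_comp _ (fun A : 'M[R]_3 => A i j) wv (@coord_continuous _ _ _ i j v)).
(* Chosen so that det (X + t A) = t (a b A_33 + t [rem A t]): the t^2 terms are two principal 2 x 2
   minors of A weighted by a and b, the t^3 term is det A. *)
pose rem (A : 'M[R]_3) t :=
  a * (A 1 1 * A ord_max ord_max - A 1 ord_max * A ord_max 1)
  + b * (A 0 0 * A ord_max ord_max - A 0 ord_max * A ord_max 0) + t * \det A.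
have w33 k : a * b * w k ord_max ord_max + tau k * rem (w k) (tau k) = 0.
  apply: (mulfI (lt0r_neq0 (tau_gt0 k))); rewrite mulr0.
  have /bounded_rankE := Zrank k; rewrite ZE det_mx3 => <-.
  by rewrite /rem det_mx3 ![(X + _) _ _]mxE ![(_ *: w k) _ _]mxE /X !diag3E /=; ring.
have minor i j i1 j1 i2 j2 i3 j3 :
    w k i j * w k i1 j1 - w k i2 j2 * w k i3 j3 @[k --> \oo]
    --> v i j * v i1 j1 - v i2 j2 * v i3 j3.
  by apply: cvgB; exact: cvgM.
have remcvg : rem (w k) (tau k) @[k --> \oo] --> rem v 0.
  have detcvg : \det (w k) @[k --> \oo] --> \det v.
    rewrite det_mx3; under eq_fun do rewrite det_mx3.
    by apply: cvgD; [apply: cvgB|]; apply: cvgM; solve [exact: wcvg | exact: minor].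
  apply: cvgD; last exact: cvgM.
  by apply: cvgD; apply: cvgM; solve [exact: cvg_cst | exact: minor].
(* Since [rem] converges and [tau] tends to 0, only a b v_33 survives in the limit of a sequence
   that is identically 0. *)
have : a * b * w k ord_max ord_max + tau k * rem (w k) (tau k) @[k --> \oo]
    --> a * b * v ord_max ord_max + 0 * rem v 0.
  by apply: cvgD; apply: cvgM => //; exact: cvg_cst.
under eq_fun do rewrite w33.
move=> lim0; have abv : a * b * v ord_max ord_max + 0 * rem v 0 = 0 :> R.
  exact: norm_cvg_unique lim0 (cvg_cst 0).
move/eqP: abv.
by rewrite mul0r addr0 !mulf_eq0 (negPf a0) (negPf b0) => /eqP.
Qed.

(** Along a line contained in [S] every difference quotient equals [v], so any positive null
    sequence, here [harmonic], is a witness. *)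
Lemma tangent_cone_line m n (S : set 'M[R]_(m, n)) X v :
  (forall t, S (X + t *: v)) -> tangent_cone S X v.
Proof.
move=> Sline; exists (fun k => X + harmonic k *: v), harmonic; split => //.
- by move=> k; rewrite invr_gt0.
- exact: cvg_harmonic.
- have quotient_eq k : (harmonic k)^-1 *: (X + harmonic k *: v - X) = v.
    by rewrite addrC addKr scalerA mulVf ?scale1r// invr_neq0.
  by under eq_fun do rewrite quotient_eq; exact: cvg_cst.
Qed.

End TangentCone.

(** * The objective: lower bound, differential and gradient *)

Section Objective.
Context {R : realType}.
Implicit Types (a b c : R) (X v : 'M[R]_3).

Lemma f_exE X : f_ex X =
  2^-1 * ((X 0 0 - 1) ^+ 2 + X 0 1 ^+ 2 + X 1 0 ^+ 2 / 4 + X 1 1 ^+ 2 / 4)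
  - (X ord_max ord_max + 1) ^+ 2 / 2 + X ord_max ord_max ^+ 4 / 4.
Proof.
rewrite /f_ex /Q sqr_frob frob_innerE !big_ord_recr !big_ord0 /=.
rewrite !mxE !big_ord_recr !big_ord0 /= !mxE /=.
have i0 : lshift 1 (widen_ord (leqnSn 1) ord_max) = 0 :> 'I_3 by apply: val_inj.
have i1 : lshift 1 (ord_max : 'I_2) = 1 :> 'I_3 by apply: val_inj.
rewrite i0 i1.
by set x := X ord_max ord_max; field.
Qed.

Lemma f_ex_diag3 a b : f_ex (diag 3 [:: a; b; 0]) =
  2^-1 * ((a - 1) ^+ 2 + b ^+ 2 / 4) - 2^-1.
Proof. by rewrite f_exE !diag3E /=; field. Qed.

Lemma has_lbound_f_ex : has_lbound (range (@f_ex R)).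
Proof.
exists (- 2) => _ [X _ <-]; rewrite f_exE.
set t := X ord_max ord_max.
have t4 : - 2 <= - (t + 1) ^+ 2 / 2 + t ^+ 4 / 4.
  (* The bound -2 is chosen so that the quartic plus 2 is a sum of two squares. *)
  rewrite -subr_ge0; have -> : - (t + 1) ^+ 2 / 2 + t ^+ 4 / 4 - - 2 =
    (t ^+ 2 / 2 - 1) ^+ 2 + (t - 1) ^+ 2 / 2 by field.
  by rewrite addr_ge0// ?divr_ge0// sqr_ge0.
rewrite -addrA -mulNr; apply: le_trans t4 _.
by rewrite lerDr mulr_ge0 ?invr_ge0// !addr_ge0 ?divr_ge0 ?sqr_ge0.
Qed.

(** A coordinate is linear and continuous, hence its own differential. *)
Global Instance is_diff_coord m n (M : 'M[R]_(m, n)) i j :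
  is_diff M (fun N : 'M[R]_(m, n) => N i j) (fun N => N i j).
Proof.
apply: DiffDef; first exact: differentiable_coord.
have coordP : linear (fun N : 'M[R]_(m, n) => N i j : R).
  by move=> k A B; rewrite !mxE.
pose coordM := GRing.isLinear.Build _ _ _ _ _ coordP.
pose coordL : {linear 'M[R]_(m, n) -> R} :=
  HB.pack (fun N : 'M[R]_(m, n) => N i j : R) coordM.
by rewrite (diff_lin (f := coordL))//; exact: coord_continuous.
Qed.

Lemma diff_f_ex X v : 'd (@f_ex R) X v =
  (X 0 0 - 1) * v 0 0 + X 0 1 * v 0 1 + X 1 0 * v 1 0 / 4 + X 1 1 * v 1 1 / 4
  + (X ord_max ord_max ^+ 3 - X ord_max ord_max - 1) * v ord_max ord_max.
Proof.
(* The coordinate functions are kept opaque: unification otherwise unfolds them. *)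
have [x xE dx] : exists2 x : 'I_3 -> 'I_3 -> 'M[R]_3 -> R,
    forall i j N, x i j N = N i j & forall i j, is_diff X (x i j) (x i j).
  by exists (fun i j N => N i j) => // i j; exact: is_diff_coord.
have sE (k t : R) : k *: t = k * t by [].
(* Written with operations on functions, in the shape to which the [is_diff] rules apply. *)
have fE : @f_ex R = 2^-1 *: ((x 0 0 - cst 1) ^+ 2 + x 0 1 ^+ 2
    + 4^-1 *: (x 1 0 ^+ 2) + 4^-1 *: (x 1 1 ^+ 2))
    - 2^-1 *: ((x ord_max ord_max + cst 1) ^+ 2)
    + 4^-1 *: (x ord_max ord_max ^+ 4).
  apply/funext => N; rewrite f_exE.
  rewrite !fctE /=.
  by rewrite !sE !xE; field.
have sqr_diff (g dg : 'M[R]_3 -> R) :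
    is_diff X g dg -> is_diff X (g ^+ 2) (2%:R * g X ^+ 1 *: dg) :=
  @is_diffX _ _ g dg 1 X.
have df := is_diffD (is_diffB
  (is_diffZ 2^-1 (is_diffD (is_diffD (is_diffD
     (sqr_diff _ _ (is_diffB (dx 0 0) (is_diff_cst (1 : R) X))) (sqr_diff _ _ (dx 0 1)))
     (is_diffZ 4^-1 (sqr_diff _ _ (dx 1 0)))) (is_diffZ 4^-1 (sqr_diff _ _ (dx 1 1)))))
  (is_diffZ 2^-1 (sqr_diff _ _ (is_diffD (dx ord_max ord_max) (is_diff_cst (1 : R) X)))))
  (is_diffZ 4^-1 (is_diffX 3 (dx ord_max ord_max))).
rewrite fE diff_val.
rewrite !fctE /=.
have zv : (0 : 'M[R]_3 -> R) v = 0 by [].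
by rewrite !sE !xE !zv; field.
Qed.

Lemma grad_f_ex_diag3 a b c : grad (@f_ex R) (diag 3 [:: a; b; c]) =
  diag 3 [:: a - 1; b / 4; c ^+ 3 - c - 1].
Proof.
by apply: grad_eq => v; rewrite diff_f_ex frob_inner_diag3 !diag3E /=; field.
Qed.

End Objective.

(** The line through diag(a, b, 0) along diag(p, q, 0) keeps rank at most 2, and the residual s E_33
    is orthogonal to the cone, whose elements have zero (3,3) entry. *)
Lemma Proj_tangent_cone_diag3 {R : realType} (a b p q s : R) :
  a != 0 -> b != 0 ->
  Proj (tangent_cone (@bounded_rank R 3 3 2) (diag 3 [:: a; b; 0]))
    (diag 3 [:: p; q; s]) = [set diag 3 [:: p; q; 0]].
Proof.
move=> a0 b0; apply: Proj_orthogonal.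
  apply: tangent_cone_line => t.
  by rewrite scale_diag3 add_diag3 mulr0 addr0; exact: bounded_rank_diag3.
move=> v /(tangent_cone_rank2 a0 b0) v33.
rewrite opp_diag3 add_diag3 frob_inner_diag3 !subrr !mul0r !add0r.
by rewrite [(v + _) _ _]mxE v33 diag3E add0r oppr0 mul0rn mulr0.
Qed.

(** * Closed form of the iteration *)

Section Iterates.
Variable R : realType.

Definition iterate k : 'M[R]_3 := diag 3 [:: 1 + (- (3 / 5)) ^+ k; (3 / 5) ^+ k; 0].

Definition direction k : 'M[R]_3 :=
  diag 3 [:: - (- (3 / 5)) ^+ k; - ((3 / 5) ^+ k / 4); 0].

(** The value is 2 at k = 0; afterwards the power has absolute value below 1 and cannot be -1. *)
Lemma iterate_neq0 k : 1 + (- (3 / 5)) ^+ k != 0 :> R.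
Proof.
case: k => [|k]; first by rewrite expr0 -mulr2n pnatr_eq0.
rewrite addr_eq0; apply/eqP => k1.
have /eqP : `|(- (3 / 5)) ^+ k.+1| = 1 :> R.
  by rewrite -[in LHS](opprK (_ ^+ _)) -k1 normrN1.
by rewrite normrX normrN ger0_norm ?lt_eqF// exprn_ilt1 //; lra.
Qed.

Lemma geometric_neq0 k : (3 / 5) ^+ k != 0 :> R.
Proof. by rewrite lt0r_neq0// exprn_gt0//; lra. Qed.

Lemma Proj_direction k :
  Proj (tangent_cone (@bounded_rank R 3 3 2) (iterate k))
    (- grad (@f_ex R) (iterate k)) = [set direction k].
Proof.
rewrite grad_f_ex_diag3 opp_diag3.
rewrite Proj_tangent_cone_diag3 ?iterate_neq0 ?geometric_neq0//.
by rewrite /direction [1 + _ - 1]addrAC subrr add0r.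
Qed.

(** The curvatures 1 and 1/4 give the factors 1 - 8/5 = -3/5 and 1 - 2/5 = 3/5, of equal modulus.
    The result already has rank at most 2, so the outer projection fixes it. *)
Lemma iterateS k : iterate k + 8 / 5 *: direction k = iterate k.+1.
Proof.
rewrite /iterate /direction scale_diag3 add_diag3 mulr0 addr0 !exprS.
by congr (diag 3 [:: _; _; _]); field.
Qed.

Lemma Proj_iterate k : Proj (@bounded_rank R 3 3 2)
  (iterate k + 8 / 5 *: direction k) = [set iterate k.+1].
Proof. by rewrite iterateS Proj_id//; exact: bounded_rank_diag3. Qed.

(** Both projections are singletons at every step, so induction forces the closed form; the converse
    gives existence of a run. *)
Lemma pgd_iterateP (X0 : 'M[R]_3) : X0 = iterate 0 -> forall X V,
  pgd (@f_ex R) (@bounded_rank R 3 3 2) (8 / 5) X0 X V <->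
  (forall k, X k = iterate k) /\ (forall k, V k = direction k).
Proof.
move=> -> X V; split=> [[X0E step]|[XE VE]]; last first.
  split=> [|k]; first exact: XE.
  by rewrite !XE VE Proj_direction Proj_iterate.
have XE k : X k = iterate k.
  elim: k => // k IH; have := step k.
  by rewrite IH Proj_direction => -[->]; rewrite Proj_iterate.
by split=> // k; have := (step k).1; rewrite XE Proj_direction.
Qed.

Lemma sqr_expN k : ((- (3 / 5)) ^+ k) ^+ 2 = ((3 / 5) ^+ k) ^+ 2 :> R.
Proof. by rewrite -!exprM mulnC !exprM sqrrN. Qed.

Lemma sqr_frob_direction k :
  frob (direction k) ^+ 2 = 17 / 16 * ((3 / 5) ^+ k) ^+ 2.
Proof.
by rewrite sqr_frob_diag3 !sqrrN sqr_expN (exprMn _ _ 4^-1); field.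
Qed.

Lemma frob_direction k : frob (direction k) = Num.sqrt 17 / 4 * (3 / 5) ^+ k.
Proof.
have rhs_ge0 : 0 <= Num.sqrt 17 / 4 * (3 / 5) ^+ k :> R.
  by rewrite mulr_ge0 ?exprn_ge0 ?divr_ge0 ?sqrtr_ge0.
apply/eqP; rewrite -(eqrXn2 (n := 2)) ?frob_ge0// sqr_frob_direction.
rewrite [(_ / 4 * _) ^+ 2]exprMn [(_ / 4) ^+ 2]exprMn sqr_sqrtr//.
by apply/eqP; field.
Qed.

End Iterates.

Theorem mainTheorem2 (R : realType) :
  let f : 'M[R]_3 -> R := @f_ex R in
  let S : set 'M[R]_3 := @bounded_rank R 3 3 2 in
  let X0 : 'M[R]_3 := diag 3 [:: 2; 1; 0] in
  let Xbar : 'M[R]_3 := diag 3 [:: 1; 0; 0] in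
  let alpha : R := 8 / 5 in
  has_lbound (range f) /\
  (exists X V : nat -> 'M[R]_3, pgd f S alpha X0 X V) /\
  forall X V : nat -> 'M[R]_3, pgd f S alpha X0 X V ->
    [/\ (* (1) *)
        forall k, \rank (X k) = 2%N,
        (* (2) *)
        X k @[k --> \oo] --> Xbar /\ \rank Xbar = 1%N,
        (* (3) *)
        (forall k, frob (V k) = Num.sqrt 17 / 4 * (3 / 5) ^+ k) /\
        frob (V k) @[k --> \oo] --> (0 : R),
        (* (4) *)
        [/\ Proj (tangent_cone S Xbar) (- grad f Xbar) = [set - grad f Xbar],
            - grad f Xbar <> 0 &
            ~ stationary f S Xbar] &
        (* (5) *)
        forall k, f (X k) - f (X k.+1) >= 1 / 5 * alpha * frob (V k) ^+ 2].
Proof.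
move=> f S X0 Xbar alpha.
have X0E : X0 = iterate R 0 by rewrite /iterate !expr0.
split; first exact: has_lbound_f_ex.
split; first by exists (iterate R), (direction R); apply/(pgd_iterateP X0E).
move=> X V /(pgd_iterateP X0E)[XE VE].
have ->: X = iterate R by apply/funext.
have ->: V = direction R by apply/funext.
have q1 : `|3 / 5 : R| < 1 by rewrite ger0_norm; lra.
have geo0 := cvg_expr q1.
have Xbar_grad : - grad f Xbar = diag 3 [:: 0; 0; 1].
  by rewrite grad_f_ex_diag3 opp_diag3; congr (diag 3 [:: _; _; _]); field.
(* All matrices diag(1, 0, t) are singular, so E_33 is tangent at the limit; it is the antigradient
   there, and the derivative along it is -1. *)
have Xbar_tangent : tangent_cone S Xbar (diag 3 [:: 0; 0; 1]).
  apply: tangent_cone_line => t; apply/bounded_rankE.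
  by rewrite scale_diag3 add_diag3 det_diag3; ring.
split.
- by move=> k; rewrite rank_diag3_2 ?iterate_neq0 ?geometric_neq0.
- split; last by rewrite rank_diag3_1 ?oner_neq0.
  apply: cvg_diag3 => //; last exact: cvg_cst.
  have qN1 : `|- (3 / 5) : R| < 1 by rewrite normrN.
  by have := cvgD (cvg_cst (1 : R)) (cvg_expr qN1); rewrite addr0; apply.
- split; first exact: frob_direction.
  under eq_fun do rewrite frob_direction.
  have := cvgM (cvg_cst (Num.sqrt 17 / 4 : R)) geo0.
  by rewrite mulr0; apply.
- rewrite Xbar_grad; split; first exact: Proj_id.
    by move=> /matrixP/(_ ord_max ord_max)/eqP; rewrite diag3E mxE oner_eq0.
  move=> /(_ _ Xbar_tangent); rewrite diff_f_ex !diag3E/=; lra.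
- move=> k; rewrite /f !f_ex_diag3 sqr_frob_direction.
  rewrite ![1 + _ - 1]addrAC !subrr !add0r !sqr_expN (exprS _ k).
  rewrite -subr_ge0 /alpha.
  have q0 := sqr_ge0 ((3 / 5 : R) ^+ k).
  (* In units of (3/5)^(2k), the decrease is (5/8)(1 - 9/25) = 20/50 and the required amount is
     (1/5)(8/5)(17/16) = 17/50. *)
  rewrite (_ : _ - _ = 3 / 50 * ((3 / 5 : R) ^+ k) ^+ 2); last by field.
  by rewrite mulr_ge0.
Qed.
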